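(* Let $q$ be a prime power and $n\geq 1$. Let $\xi_1,\dots,\xi_n$ be independent random variables, each uniformly distributed on the set of squares $\{\alpha^2 : \alpha\in\mathbb{F}_q\}\subseteq\mathbb{F}_q$, and let $P(x)=x^n+\xi_1x^{n-1}+\xi_2x^{n-2}+\dots+\xi_n\in\mathbb{F}_q[x]$. Then \[ \Pr\big[P(x)\text{ is irreducible over }\mathbb{F}_q\big]=\frac1n+O_n\big(q^{-1/2}\big) \] as $q\to\infty$, where the implied constant depends only on $n$. *)

(* Defs.v *)
From HB Require Import structures.
From mathcomp Require Import all_boot all_order all_algebra.
From mathcomp Require Import all_classical all_reals all_analysis.

Set Implicit Arguments.
Unset Strict Implicit.
Unset Printing Implicit Defensive.

Import Order.TTheory GRing.Theory Num.Theory.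

Local Open Scope classical_set_scope.
Local Open Scope ring_scope.

Definition squares (F : finFieldType) : {set F} := [set a ^+ 2 | a in F]%SET.

(* Measurability with respect to the discrete sigma-algebra on the target. *)
Definition discrete_rv (d : measure_display) (T : measurableType d)
    (V : Type) (X : T -> V) : Prop :=
  forall B : set V, measurable (X @^-1` B).

Definition mutually_independent (R : realType) (d : measure_display)
    (T : measurableType d) (P : probability T R) (I : finType) (V : Type)
    (X : I -> T -> V) : Prop :=
  forall (J : {set I}) (B : I -> set V),
    P (\bigcap_(i in [set` J]) (X i @^-1` B i)) =
    (\prod_(i in J) P (X i @^-1` B i))%E.

Definition uniform_on (R : realType) (d : measure_display)
    (T : measurableType d) (P : probability T R) (V : finType)
    (S : {set V}) (X : T -> V) : Prop :=
  forall a : V,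
    P (X @^-1` [set a]) = (if a \in S then (#|S|%:R)^-1 else 0)%:E.

(* x^n + c_1 x^(n-1) + ... + c_n; the index i : 'I_n stands for c_(i+1). *)
Definition monic_poly_of (F : fieldType) (n : nat) (c : 'I_n -> F) :
    {poly F} :=
  'X^n + \sum_(i < n) c i *: 'X^(n - i.+1).

(* Main.v *)
Require Import Defs.
From mathcomp Require Import all_boot all_order all_fingroup all_algebra all_field.
From mathcomp Require Import all_classical all_reals all_analysis.
From mathcomp Require Import ring lra zify.

Set Implicit Arguments.
Unset Strict Implicit.
Unset Printing Implicit Defensive.

Import Order.TTheory GRing.Theory Num.Theory.

Local Open Scope classical_set_scope.
Local Open Scope ring_scope.

(** For odd q, let chi be the quadratic character of F_q. Up to an error O(1/q)
    caused by vanishing coefficients, a coefficient c is a square with weight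
    (1 + chi(c))/2, so the probability is q^(-n) times the number of monic
    irreducible polynomials of degree n, plus the normalized sums T(S) of
    prod_(i in S) chi(c_i) over irreducible polynomials, for nonempty sets S of
    indices. The point is that T(S) = O(q^(n-1/2)) without using the Weil bound.

    Irreducibility is invariant under x -> x + b. Average the summand over b,
    apply Cauchy-Schwarz, and then drop the irreducibility condition: it remains
    to bound, for b <> 0, the correlation over all monic f of the character
    products of f(x) and f(x + b). Let m be the largest index in S. Summing over
    c_m first, the inner sum is that of chi(t) chi(t + l), which is bounded unless
    l = 0; here l is an affine function of the other coefficients, not identically
    zero as soon as m > n/2, even in small characteristic.

    If m <= n/2, the reversal x^n f(1/x)/c_n turns T(S) into T(S') with
    S' = {n - i : i in S}, together with n if |S| is odd, and max S' > n/2. *)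

(** * Monic polynomials and translations *)

Section MonicPolynomials.
Variables (F : fieldType) (n : nat).
Implicit Types (c v : {ffun 'I_n -> F}) (p : {poly F}) (a b t : F).

Definition low_poly v : {poly F} := \sum_(i < n) v i *: 'X^(n - i.+1).

Lemma monic_polyE c : monic_poly_of c = 'X^n + low_poly c.
Proof. by []. Qed.

Lemma coef_low_poly v (i : 'I_n) : (low_poly v)`_(n - i.+1) = v i.
Proof.
rewrite coef_sum (bigD1 i) //= coefZ coefXn eqxx mulr1 big1 ?addr0 // => j ji.
rewrite coefZ coefXn; case: eqP => [e|_]; last by rewrite mulr0.
by case/eqP: ji; apply: val_inj => /=; have := ltn_ord i; have := ltn_ord j; lia.
Qed.

Lemma size_low_poly v : (size (low_poly v) <= n)%N.
Proof.
apply: (leq_trans (size_sum _ _ _)); apply/bigmax_leqP => i _.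
apply: (leq_trans (size_scale_leq _ _)); rewrite size_polyXn.
by have := ltn_ord i; lia.
Qed.

Lemma low_polyD u v : low_poly (u + v) = low_poly u + low_poly v.
Proof.
by rewrite -big_split; apply: eq_bigr => i _; rewrite ffunE scalerDl.
Qed.

Lemma low_polyZ t v : low_poly [ffun i => t * v i] = t *: low_poly v.
Proof.
by rewrite scaler_sumr; apply: eq_bigr => i _; rewrite ffunE scalerA.
Qed.

Lemma low_polyK p : (size p <= n)%N -> low_poly [ffun i : 'I_n => p`_(n - i.+1)] = p.
Proof.
move=> sp; apply/polyP => j; have [jn|nj] := ltnP j n; last first.
  by rewrite !nth_default // ?(leq_trans _ nj) // size_low_poly.
have kn : (n - j.+1 < n)%N by lia.
have := coef_low_poly [ffun i : 'I_n => p`_(n - i.+1)] (Ordinal kn).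
by rewrite ffunE /=; have -> : (n - (n - j.+1).+1)%N = j by lia.
Qed.

Lemma coef_monic_poly c (i : 'I_n) : (monic_poly_of c)`_(n - i.+1) = c i.
Proof.
rewrite monic_polyE coefD coef_low_poly coefXn.
by case: eqP => [e|_]; [have := ltn_ord i; lia|rewrite add0r].
Qed.

Lemma size_monic_poly c : size (monic_poly_of c) = n.+1.
Proof. by rewrite size_polyDl size_polyXn // ltnS size_low_poly. Qed.

Lemma monic_polyP c : monic_poly_of c \is monic.
Proof.
by rewrite monicE lead_coefDl ?lead_coefXn // size_polyXn ltnS size_low_poly.
Qed.

Lemma monic_poly_neq0 c : monic_poly_of c != 0.
Proof. exact/monic_neq0/monic_polyP. Qed.

Lemma monic_polyK p : p \is monic -> size p = n.+1 ->
  monic_poly_of [ffun i : 'I_n => p`_(n - i.+1)] = p.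
Proof.
move=> mp sp; have e : p = 'X^n + (p - 'X^n) by rewrite addrC subrK.
have sl : (size (p - 'X^n)%R <= n)%N.
  apply/leq_sizeP => j; rewrite leq_eqVlt => /predU1P[<-|nj].
    by move: mp; rewrite coefB coefXn eqxx monicE lead_coefE sp => /eqP ->; rewrite subrr.
  by rewrite coefB coefXn gtn_eqF // subr0 nth_default // sp.
rewrite monic_polyE [RHS]e -[X in _ = _ + X](low_polyK sl); congr (_ + low_poly _).
apply/ffunP => i; rewrite !ffunE coefB coefXn.
by case: eqP => [|_]; [have := ltn_ord i; lia|rewrite subr0].
Qed.

Lemma monic_poly_inj c v : monic_poly_of c = monic_poly_of v -> c = v.
Proof.
by move=> e; apply/ffunP => i; rewrite -!coef_monic_poly e.
Qed.

Definition translate b c : {ffun 'I_n -> F} :=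
  [ffun i : 'I_n => (monic_poly_of c \Po ('X + b%:P))`_(n - i.+1)].

Lemma monic_translate b c :
  monic_poly_of (translate b c) = monic_poly_of c \Po ('X + b%:P).
Proof.
apply: monic_polyK.
  rewrite monicE lead_coef_comp ?size_XaddC // lead_coefXaddC expr1n mulr1.
  exact/eqP/monicP/monic_polyP.
by rewrite size_comp_poly2 ?size_XaddC // size_monic_poly.
Qed.

Lemma translateD a b c : translate b (translate a c) = translate (a + b) c.
Proof.
apply: monic_poly_inj; rewrite !monic_translate -comp_polyA; congr (_ \Po _).
by rewrite comp_polyD comp_polyX comp_polyC polyCD -addrA [_%:P + _]addrC.
Qed.

Lemma translate0 c : translate 0 c = c.
Proof.
by apply: monic_poly_inj; rewrite monic_translate addr0 comp_polyXr.
Qed.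

Lemma translateK b : cancel (translate b) (translate (- b)).
Proof. by move=> c; rewrite translateD subrr translate0. Qed.

Lemma irreducible_comp_XaddC p b :
  irreducible_poly p -> irreducible_poly (p \Po ('X + b%:P)).
Proof.
case=> sp irr; split; first by rewrite size_comp_poly2 ?size_XaddC.
move=> q sq /dvdpP[r e].
have e' : p = (r \Po ('X - b%:P)) * (q \Po ('X - b%:P)).
  by rewrite -comp_polyM -e comp_polyXaddC_K.
have : q \Po ('X - b%:P) %= p.
  by apply: irr; rewrite ?size_comp_poly2 ?size_XsubC // e' dvdp_mull.
move/eqp_size; rewrite size_comp_poly2 ?size_XsubC // => sqp.
rewrite -dvdp_size_eqp ?e ?dvdp_mull // -e.
by rewrite size_comp_poly2 ?size_XaddC // sqp.
Qed.

Lemma irreducible_translate b c :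
  irreducible_poly (monic_poly_of (translate b c)) <->
  irreducible_poly (monic_poly_of c).
Proof.
split=> [/(@irreducible_comp_XaddC _ (- b))|irr].
  by rewrite -monic_translate translateK.
by rewrite monic_translate; apply: irreducible_comp_XaddC.
Qed.

Definition unit_dir (m : 'I_n) t : {ffun 'I_n -> F} :=
  [ffun i => if i == m then t else 0].

Lemma low_poly_unit_dir m t : low_poly (unit_dir m t) = t *: 'X^(n - m.+1).
Proof.
rewrite /low_poly (bigD1 m) //= ffunE eqxx big1 ?addr0 // => i /negbTE im.
by rewrite ffunE im scale0r.
Qed.

(** Composing the added term [t *: 'X^(n - m.+1)] with ['X + b%:P] keeps its degree and leading
    coefficient, so coefficient [m] moves by [t] and those of smaller index stay put. This is what
    allows averaging over [c m] alone. *)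
Lemma translate_unit_dir b c (m i : 'I_n) t : (i <= m)%N ->
  translate b (c + unit_dir m t) i = translate b c i + unit_dir m t i.
Proof.
move=> im; rewrite !ffunE !monic_polyE low_polyD addrA comp_polyD coefD.
congr (_ + _); rewrite low_poly_unit_dir comp_polyZ coefZ comp_Xn_poly.
have sz : size (('X + b%:P) ^+ (n - m.+1)) = (n - m.+1).+1.
  by rewrite -[b]opprK polyCN size_exp_XsubC.
case: eqP => [->|/eqP ne].
  have : ('X + b%:P) ^+ (n - m.+1) \is monic by rewrite monic_exp // monicXaddC.
  by rewrite monicE lead_coefE sz => /eqP ->; rewrite mulr1.
rewrite nth_default ?mulr0 // sz.
have : i != m :> nat by []; have := ltn_ord m; lia.
Qed.

(** At [k = n - m.+1] this is the offset between coefficient [m] of a polynomial and that of its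
    translate. It is linear in [p], hence affine in the coefficients of a monic polynomial. *)
Definition shift_coef b k p := (p \Po ('X + b%:P))`_k - p`_k.

Lemma shift_coefD b k p q :
  shift_coef b k (p + q) = shift_coef b k p + shift_coef b k q.
Proof. by rewrite /shift_coef comp_polyD !coefD; ring. Qed.

Lemma shift_coefZ b k t p : shift_coef b k (t *: p) = t * shift_coef b k p.
Proof. by rewrite /shift_coef comp_polyZ !coefZ; ring. Qed.

(** The translate ['X^k.+1 * ('X + b%:P) ^+ k] has no term of degree [k], whereas the original has
    coefficient [(- b) ^+ k.+1] there. Unlike the shift of a monomial, this involves no binomial
    coefficient that could vanish in small characteristic. *)
Lemma shift_coef_witness b k : b != 0 ->
  shift_coef b k (('X - b%:P) ^+ k.+1 * 'X^k) != 0.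
Proof.
move=> b0; rewrite /shift_coef comp_polyM comp_Xn_poly [_ ^+ _ \Po _]rmorphXn /=.
rewrite comp_polyB comp_polyX comp_polyC addrK coefXnM ltnSn.
rewrite coefMXn ltnn subnn sub0r oppr_eq0.
by rewrite -horner_coef0 !hornerE expf_neq0 // oppr_eq0.
Qed.

End MonicPolynomials.

(** * The quadratic character *)

Section QuadraticCharacter.
Variables (R : realFieldType) (F : finFieldType).
Implicit Types x y : F.

Definition qchar x : R :=
  if x == 0 then 0 else if x \in squares F then 1 else -1.

Lemma qchar0 : qchar 0 = 0.
Proof. by rewrite /qchar eqxx. Qed.

Lemma qchar_le1 x : `|qchar x| <= 1.
Proof.
by rewrite /qchar; do 2?case: ifP => _; rewrite ?normrN ?normr0 ?normr1.
Qed.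

Lemma squaresP x : reflect (exists a, x = a ^+ 2) (x \in squares F).
Proof. by apply: (iffP imsetP) => [[a _ ->]|[a ->]]; exists a. Qed.

Lemma squares0 : 0 \in squares F.
Proof. by apply/squaresP; exists 0; rewrite expr0n. Qed.

Lemma squaresM x y : x \in squares F -> x != 0 ->
  (x * y \in squares F) = (y \in squares F).
Proof.
move=> /squaresP[a ->] a0; apply/squaresP/squaresP => -[b e].
  exists (b / a); rewrite exprMn exprVn -e mulrAC mulfV ?mul1r //.
by exists (a * b); rewrite exprMn -e.
Qed.

Hypothesis F2 : 2%:R != 0 :> F.

Let Q := (squares F :\ 0)%SET.

(** Squaring maps the nonzero elements to the nonzero squares, and the fibre over [a ^+ 2] consists
    of [a] and [- a], distinct because 2 is nonzero. *)
Lemma card_nonzero_squares : (#|F|.-1 = #|Q|.*2)%N.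
Proof.
have -> : #|F|.-1 = #|[set~ (0 : F)]%SET| by rewrite cardsC1.
rewrite -sum1_card (partition_big (fun x => x ^+ 2) [in Q]) /=; last first.
  move=> x; rewrite !inE => x0; rewrite expf_neq0 //=.
  by apply/squaresP; exists x.
rewrite -muln2 -sum_nat_const; apply: eq_bigr => y.
rewrite !inE => /andP[y0 /squaresP[a ea]].
have a0 : a != 0 by apply: contraNneq y0 => a0; rewrite ea a0 expr0n.
have aNa : a != - a.
  by rewrite -subr_eq0 opprK -mulr2n -mulr_natr mulf_neq0.
transitivity #|[set a; - a]%SET|; last by rewrite cards2 aNa.
rewrite sum1_card.
apply: eq_card => x; rewrite !inE unfold_in /= !inE ea eqf_sqr.
case: (x =P a) => [->|]; rewrite ?a0 //=.
by case: (x =P - a) => [->|]; rewrite ?oppr_eq0 ?a0 ?andbF.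
Qed.

Lemma card_squares_odd : ((#|squares F|).*2 = #|F|.+1)%N.
Proof.
have := card_nonzero_squares; rewrite (cardsD1 0 (squares F)) squares0 -/Q.
by have := finNzRing_gt1 F; move: #|Q| #|F| => a b; lia.
Qed.

Lemma sum_qchar : \sum_x qchar x = 0.
Proof.
rewrite (bigD1 0) //= qchar0 add0r.
rewrite (bigID [in squares F]) /=.
rewrite (eq_bigr (fun=> 1)); last by move=> x /andP[/negbTE x0 xQ]; rewrite /qchar x0 xQ.
rewrite [X in _ + X](eq_bigr (fun=> -1)); last first.
  by move=> x /andP[/negbTE x0 /negbTE xQ]; rewrite /qchar x0 xQ.
rewrite !sumr_const.
have -> : #|[pred x : F | (x != 0) && (x \in squares F)]| = #|Q|.
  by apply: eq_card => x; rewrite !inE.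
have e : #|[set~ (0 : F)]%SET| = #|Q|.*2 by rewrite cardsC1 card_nonzero_squares.
have -> : #|[pred x : F | (x != 0) && (x \notin squares F)]| = #|Q|.
  apply/eqP; rewrite -(eqn_add2l #|Q|) addnn -e; apply/eqP.
  rewrite -[RHS](cardsID (squares F)); congr (_ + _)%N.
    by apply: eq_card => x; rewrite !inE.
  by apply: eq_card => x; rewrite !inE andbC.
by rewrite mulNrn subrr.
Qed.

(** The nonzero squares and their multiples by [x] are disjoint, and by cardinality they exhaust the
    nonzero elements. So [y = x * s] with [s] a square, and [x * y = x ^+ 2 * s]. *)
Lemma nonsquareM x y : x \notin squares F -> y \notin squares F ->
  x * y \in squares F.
Proof.
move=> xN yN.
have x0 : x != 0 by apply: contraNneq xN => ->; exact: squares0.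
have y0 : y != 0 by apply: contraNneq yN => ->; exact: squares0.
pose xQ := [set x * z | z in Q]%SET.
have cxQ : #|xQ| = #|Q| by rewrite card_imset //; apply: mulfI.
have dj : [disjoint Q & xQ]%B.
  apply/pred0P => z /=; apply/negbTE/andP => -[zQ /imsetP[s sQ ez]].
  move: zQ sQ; rewrite !inE => /andP[z0 zS] /andP[s0 sS].
  by case/negP: xN; rewrite -(squaresM x sS s0) mulrC -ez.
have sub : (Q :|: xQ \subset [set~ (0 : F)])%SET.
  apply/fintype.subsetP => z; rewrite !inE => /orP[/andP[]//|/imsetP[s]].
  by rewrite !inE => /andP[s0 _] ->; rewrite mulf_neq0.
have /eqP e : (Q :|: xQ == [set~ (0 : F)])%SET.
  rewrite eqEcard sub cardsC1 card_nonzero_squares.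
  by rewrite cardsU disjoint_setI0 // cards0 subn0 cxQ addnn /=.
have : y \in (Q :|: xQ)%SET by rewrite e !inE.
rewrite !inE (negbTE yN) andbF /= => /imsetP[s]; rewrite !inE => /andP[s0 sS] ->.
by rewrite mulrA mulrC squaresM //; apply/squaresP; exists x.
Qed.

Lemma qcharM x y : qchar (x * y) = qchar x * qchar y.
Proof.
rewrite /qchar mulf_eq0.
have [->|x0] := eqVneq x 0; first by rewrite /= mul0r.
have [->|y0] := eqVneq y 0; first by rewrite /= mulr0.
case: (boolP (x \in squares F)) => xS /=; first by rewrite squaresM // mul1r.
case: (boolP (y \in squares F)) => yS.
  by rewrite mulrC squaresM // (negbTE xS) mulr1.
by rewrite nonsquareM // mulrNN mulr1.
Qed.

Lemma qchar1 : qchar 1 = 1.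
Proof.
rewrite /qchar oner_eq0; rewrite ifT //.
by apply/squaresP; exists 1; rewrite expr1n.
Qed.

Lemma qcharV x : qchar x^-1 = qchar x.
Proof.
have [->|x0] := eqVneq x 0; first by rewrite invr0.
have -> : x^-1 = (x^-1 ^+ 2) * x by rewrite expr2 -mulrA mulVf // mulr1.
rewrite qcharM {1}/qchar expf_eq0 /= invr_eq0 (negbTE x0).
by rewrite ifT ?mul1r //; apply/squaresP; exists x^-1.
Qed.

Lemma qcharMM x : x != 0 -> qchar x * qchar x = 1.
Proof.
by rewrite /qchar => /negbTE ->; case: ifP => _; rewrite ?mulrNN mulr1.
Qed.

Lemma qchar_pair_sum_le1 l : l != 0 -> `|\sum_t qchar t * qchar (t + l)| <= 1.
Proof.
move=> l0; rewrite (bigD1 0) //= qchar0 mul0r add0r.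
(* [chi(t) chi(t + l) = chi(1 + l/t)] for [t <> 0] *)
have -> : \sum_(t | t != 0) qchar t * qchar (t + l)
    = \sum_(u | u != 1) qchar u.
  rewrite (reindex_onto (fun u => l / (u - 1)) (fun t => 1 + l / t)) /=; last first.
    by move=> t t0; rewrite addrC addKr invf_div mulrCA mulfV ?mulr1.
  apply: eq_big => [u|u].
    have [->|u1] := eqVneq u 1; first by rewrite subrr invr0 mulr0 eqxx.
    have u1' : u - 1 != 0 by rewrite subr_eq0.
    by rewrite mulf_neq0 ?invr_eq0 //= invf_div mulrCA mulfV // mulr1 addrC subrK eqxx.
  case/andP=> t0 _.
  have u1 : u - 1 != 0.
    by apply: contraNneq t0 => ->; rewrite invr0 mulr0.
  have -> : l / (u - 1) + l = l / (u - 1) * u by field.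
  by rewrite [X in _ * X]qcharM mulrA qcharMM ?mul1r.
(* The full character sum is zero, so leaving out [u = 1] gives exactly -1. *)
have := sum_qchar; rewrite (bigD1 1) //= qchar1 => /eqP.
by rewrite addrC addr_eq0 => /eqP ->; rewrite normrN normr1.
Qed.

End QuadraticCharacter.

(** * Counting irreducible polynomials *)

Section FrobeniusRoots.
Variables (F : finFieldType) (n : nat).
Hypothesis n_gt0 : (0 < n)%N.

(** Translation by 1 permutes the field, so adding [#|F|%:R] to the sum of all elements does not
    change it. *)
Lemma card_natr_eq0 : #|F|%:R = 0 :> F.
Proof.
apply: (@addrI _ (\sum_(x : F) x)); rewrite addr0 -sumr_const -big_split /=.
by rewrite [RHS](reindex_inj (addIr (1 : F))).
Qed.

Let N := (#|F| ^ n)%N.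

Let N_gt1 : (1 < N)%N.
Proof. by rewrite -(expn0 #|F|) ltn_exp2l // finNzRing_gt1. Qed.

Let size_XnsubX (K : fieldType) : size ('X^N - 'X : {poly K}) = N.+1.
Proof. by rewrite size_polyDl size_polyXn // size_polyN size_polyX. Qed.

Lemma separable_XnsubX : separable_poly ('X^N - 'X : {poly F}).
Proof.
rewrite unlock derivB derivXn derivX -scaler_nat natrX card_natr_eq0.
rewrite expr0n gtn_eqF // scale0r sub0r -[- 1]scaleN1r coprimepZr ?coprimep1 //.
by rewrite oppr_eq0 oner_eq0.
Qed.

(** Adjoining a root [z] of [p] yields a field with [N] elements, in which [z ^+ N = z]. The two
    polynomials thus share a root, and the irreducible one divides the other. *)
Lemma irreducible_dvd_XnsubX (p : {poly F}) :
  irreducible_poly p -> size p = n.+1 -> p %| 'X^N - 'X.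
Proof.
move=> irr sp; have [K dimK [z pz _]] := irredp_FAdjoin irr.
apply: contraT; rewrite -irreducible_poly_coprime //.
rewrite -(coprimep_map (in_alg K)) => /coprimep_root/(_ pz)/negP[].
rewrite rmorphB /= rmorphXn /= map_polyX !hornerE subr_eq0.
have := @expf_card (FinFieldExtType K) z.
have -> : #|FinFieldExtType K| = N.
  rewrite -[LHS](@card_vspacef F (FinFieldExtType K) (Vector.on K)).
  by rewrite card_vspace dimK sp.
by move=> ->.
Qed.

Lemma irreducible_common_root (L : fieldExtType F) (p q : {poly F}) (z : L) :
    irreducible_poly p -> irreducible_poly q -> p \is monic -> q \is monic ->
  root (map_poly (in_alg L) p) z -> root (map_poly (in_alg L) q) z -> p = q.
Proof.
move=> ip iq mp mq pz qz; apply/eqP; rewrite -eqp_monic //.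
have ncop : ~~ coprimep p q.
  by rewrite -(coprimep_map (in_alg L)); apply/negP => /coprimep_root/(_ pz)/negP.
have pq : p %| q by move: ncop; rewrite irreducible_poly_coprime // negbK.
have qp : q %| p.
  by move: ncop; rewrite coprimep_sym irreducible_poly_coprime // negbK.
exact/andP.
Qed.

(** The Galois generator [a] acts as the Frobenius map, and the roots form the fixed field [E] of
    its [n]-th power. Having [N] elements, [E] has dimension [n] over [F], which bounds the degree
    of each root by [n]. *)
Lemma XnsubX_splitting : exists (L : fieldExtType F) (zs : seq L),
  [/\ uniq zs, size zs = N,
      map_poly (in_alg L) ('X^N - 'X) %= \prod_(z <- zs) ('X - z%:P)
    & forall z, z \in zs -> (size (minPoly 1 z) <= n.+1)%N].
Proof.
have nz : 'X^N - 'X != 0 :> {poly F} by rewrite -size_poly_gt0 size_XnsubX.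
have [L [zs Dzs _]] := FinSplittingFieldFor nz.
have Uzs : uniq zs.
  by rewrite -separable_prod_XsubC -(eqp_separable Dzs) separable_map separable_XnsubX.
have szs : size zs = N.
  apply: succn_inj; rewrite -(size_prod_XsubC _ id) -(eqp_size Dzs).
  by rewrite size_map_poly size_XnsubX.
exists L, zs; split=> // z zzs.
have [a _ Da] := finField_galois_generator (sub1v {:L}).
rewrite dimv1 expn1 in Da.
pose E := fixedSpace (a ^+ n)%g.
have zsE : zs =i E.
  move=> x; rewrite -root_prod_XsubC -(eqp_root Dzs) (sameP fixedSpaceP eqP).
  rewrite rmorphB /= rmorphXn /= map_polyX /root !hornerE subr_eq0 /N.
  congr (_ == x); elim: (n) => [|k IH]; first by rewrite gal_id.
  by rewrite expgSr expnSr exprM IH galM ?Da ?memvf.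
have dimE : \dim E = n.
  apply/eqP; rewrite -(eqn_exp2l _ _ (finNzRing_gt1 F)) -/N -szs.
  rewrite -(@card_vspace F (FinFieldExtType L) (Vector.on L) E).
  rewrite -(card_uniqP (Uzs : @uniq (FinFieldExtType L) zs)).
  by apply/eqP/eq_card => x; rewrite zsE.
rewrite size_minPoly ltnS -dimE adjoin_degreeE dimv1 divn1.
apply: dimvS; rewrite -[E]subfield_closed agenvS // subv_add sub1v /=.
by rewrite -memvE -zsE.
Qed.

End FrobeniusRoots.

Definition irr_set (F : finFieldType) (n : nat) : {set {ffun 'I_n -> F}} :=
  [set c : {ffun 'I_n -> F} | `[< irreducible_poly (monic_poly_of c) >]]%SET.

Lemma irr_setP (F : finFieldType) n (c : {ffun 'I_n -> F}) :
  reflect (irreducible_poly (monic_poly_of c)) (c \in irr_set F n).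
Proof. by rewrite inE; apply: asboolP. Qed.

Section CountIrreducible.
Variables (F : finFieldType) (n : nat).
Hypothesis n_gt0 : (0 < n)%N.
Local Notation I := (irr_set F n).

Lemma irreducible_minPoly (L : fieldExtType F) (z : L) (p : {poly F}) :
  minPoly 1 z = map_poly (in_alg L) p -> irreducible_poly p.
Proof.
move=> e; split.
  by rewrite -(size_map_poly (in_alg L)) -e size_minPoly.
move=> q sq qp.
have Kq : map_poly (in_alg L) q \is a polyOver 1%VS by apply/polyOver1P; exists q.
have /(minPoly_irr Kq)/orP[] : map_poly (in_alg L) q %| minPoly 1 z.
- by rewrite e dvdp_map.
- by rewrite e eqp_map.
- by rewrite -size_poly_eq1 size_map_poly (negbTE sq).
Qed.

(** Count pairs of an irreducible polynomial of degree [n] and a root of it in [zs]. Each polynomial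
    has [n] roots there and each [z] serves at most one polynomial, whence the first inequality. An
    unserved [z] has degree below [n], so it is a root of one of the [#|F| ^ n.-1] monic polynomials
    of degree [n.-1], each with at most [n.-1] roots. *)
Lemma count_irreducible :
  (n * #|I| <= #|F| ^ n)%N /\ (#|F| ^ n <= n * #|I| + n * #|F| ^ n.-1)%N.
Proof.
have [L [zs [Uzs szs Dzs degzs]]] := XnsubX_splitting F n_gt0.
pose rt m (c : {ffun 'I_m -> F}) z := root (map_poly (in_alg L) (monic_poly_of c)) z.
have sumE (p : pred L) : (\sum_(z <- zs) p z = count p zs)%N.
  by rewrite -sum1_count [RHS]big_mkcond; apply: eq_bigr => z _; case: (p z).
have cnt m (c : {ffun 'I_m -> F}) : (\sum_(z <- zs) rt m c z <= m)%N.
  rewrite sumE -size_filter -ltnS -(size_monic_poly c).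
  rewrite -(size_map_poly (in_alg L)).
  by rewrite max_poly_roots ?filter_uniq ?filter_all // map_poly_eq0 monic_poly_neq0.
have cntI c : c \in I -> (\sum_(z <- zs) rt n c z = n)%N.
  move=> /irr_setP irr; rewrite sumE.
  have := irreducible_dvd_XnsubX irr (size_monic_poly c).
  rewrite -(dvdp_map (in_alg L)) (eqp_dvdr _ Dzs) => /dvdp_prod_XsubC[k Dk].
  have -> : count (rt n c) zs = size (mask k zs).
    rewrite (mask_filter k Uzs) size_filter; apply: eq_count => z.
    by rewrite /rt (eqp_root Dk) root_prod_XsubC.
  apply: succn_inj; rewrite -(size_prod_XsubC _ id) -(eqp_size Dk).
  by rewrite size_map_poly size_monic_poly.
have sumI : (n * #|I| = \sum_(z <- zs) \sum_(c in I) rt n c z)%N.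
  rewrite exchange_big /= mulnC -sum_nat_const; apply: eq_bigr => c /cntI ->.
  by [].
have I1 z : (\sum_(c in I) rt n c z <= 1)%N.
  have -> : (\sum_(c in I) rt n c z = #|[set c in I | rt n c z]|)%N.
    rewrite -sum1_card big_mkcond [RHS]big_mkcond; apply: eq_bigr => c _.
    by rewrite inE; case: (c \in I) (rt n c z) => [] [].
  apply/card_le1_eqP => c d; rewrite !inE => /andP[/asboolP ic cz] /andP[/asboolP id dz].
  apply/monic_poly_inj/(irreducible_common_root id ic _ _ dz cz);
    exact: monic_polyP.
split; first by rewrite sumI -szs -sum1_size leq_sum.
rewrite -szs -sum1_size sumI.
apply: (@leq_trans (\sum_(z <- zs) (\sum_(c in I) rt n c z +
   \sum_(c : {ffun 'I_n.-1 -> F}) rt n.-1 c z))); last first.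
  rewrite big_split leq_add2l exchange_big /=.
  apply: (@leq_trans (\sum_(c : {ffun 'I_n.-1 -> F}) n.-1)).
    by apply: leq_sum.
  rewrite sum_nat_const card_ffun card_ord mulnC leq_mul2r leq_pred.
  by rewrite orbT.
rewrite big_seq [leqRHS]big_seq; apply: leq_sum => z /degzs sz.
have /polyOver1P[p Dp] := minPolyOver 1 z.
have irr := irreducible_minPoly Dp.
have mp : p \is monic by rewrite -(map_monic (in_alg L)) -Dp monic_minPoly.
have pz : root (map_poly (in_alg L) p) z by rewrite -Dp root_minPoly.
rewrite Dp size_map_poly leq_eqVlt in sz; case/predU1P: sz => sz.
  have e := monic_polyK mp sz.
  rewrite (bigD1 [ffun i : 'I_n => p`_(n - i.+1)]) /=; last by apply/irr_setP; rewrite e.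
  by rewrite /rt e pz -!addnA.
(* A minimal polynomial of degree below [n] is padded by a power of ['X] to degree exactly
   [n.-1]. *)
have mq : 'X^(n - size p) * p \is monic by rewrite rpredM ?monicXn.
have sq : size ('X^(n - size p) * p) = n.-1.+1.
  by rewrite mulrC size_mulXn ?monic_neq0 // prednK // subnK.
have e := monic_polyK mq sq.
rewrite addnC (bigD1 [ffun i : 'I_n.-1 => ('X^(n - size p) * p)`_(n.-1 - i.+1)]) //=.
by rewrite /rt e rmorphM /= rootM pz orbT -!addnA.
Qed.

End CountIrreducible.

(** * Character sums over irreducible polynomials *)

Section CharacterSums.
Variables (R : realFieldType) (F : finFieldType) (n : nat).
Hypothesis F2 : 2%:R != 0 :> F.
Implicit Types (c v : {ffun 'I_n -> F}) (S : {set 'I_n}) (m : 'I_n).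
Local Notation q := (#|F|%:R : R).
Local Notation chi := (@qchar R F).

(** Cauchy-Schwarz against the constant 1, by expanding the sum of all squared differences. *)
Lemma sqr_sum_le (I : finType) (A : {pred I}) (f : I -> R) :
  (\sum_(i in A) f i) ^+ 2 <= #|A|%:R * \sum_(i in A) f i ^+ 2.
Proof.
have : 0 <= \sum_(i in A) \sum_(j in A) (f i - f j) ^+ 2.
  by do 2?[apply: sumr_ge0 => ? _]; apply: sqr_ge0.
have -> : \sum_(i in A) \sum_(j in A) (f i - f j) ^+ 2 =
    2%:R * (#|A|%:R * \sum_(i in A) f i ^+ 2) - 2%:R * (\sum_(i in A) f i) ^+ 2.
  transitivity (\sum_(i in A) (f i ^+ 2 *+ #|A| - f i * (2%:R * \sum_(j in A) f j)
      + \sum_(j in A) f j ^+ 2)).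
    apply: eq_bigr => i _.
    rewrite mulr_sumr mulr_sumr -sumr_const -sumrB -big_split /=.
    by apply: eq_bigr => j _; ring.
  rewrite big_split sumrB /= sumrMnl -mulr_suml sumr_const.
  by rewrite -[X in X - _]mulr_natl -[X in _ + X]mulr_natl; ring.
by rewrite subr_ge0 ler_pM2l ?ltr0n.
Qed.

(** If the linear part is nonzero at some [u], each line in direction [u] meets the zero set at most
    once. Otherwise the affine function is constant, and the witness shows that the constant is
    nonzero. *)
Lemma card_shift_coef_eq0 (b : F) m : b != 0 -> (n <= m.*2.+1)%N ->
  (#|F| * #|[set c : {ffun 'I_n -> F} |
      shift_coef b (n - m.+1) (monic_poly_of c) == 0%R]%SET|
    <= #|F| ^ n)%N.
Proof.
move=> b0 nm; set L := shift_coef b _.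
have [u Lu|L0] := pickP (fun v => L (low_poly v) != 0).
  rewrite -sum1_card -sum_nat_const.
  rewrite (_ : \sum_(i : F) _ = \sum_(t : F) \sum_(c : {ffun 'I_n -> F})
      ((L (monic_poly_of c) + t * L (low_poly u))%R == 0%R))%N.
    rewrite exchange_big /=.
    apply: (@leq_trans (\sum_(c : {ffun 'I_n -> F}) 1)); last first.
      by rewrite sum1_card card_ffun card_ord.
    apply: leq_sum => c _; rewrite (bigD1 (- (L (monic_poly_of c) / L (low_poly u)))) //=.
    rewrite big1 ?addn0 ?leq_b1 // => t tn; apply/eqP; rewrite eqb0.
    apply: contraNneq tn => e; apply/eqP; apply: (mulIf Lu).
    by rewrite mulNr divfK //; apply/eqP; rewrite -addr_eq0 addrC e.
  apply: eq_bigr => t _; rewrite big_mkcond /=.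
  rewrite (reindex_inj (addIr [ffun i => t * u i])) /=; apply: eq_bigr => c _.
  rewrite inE !monic_polyE low_polyD low_polyZ addrA /L shift_coefD shift_coefZ.
  by case: ifP.
rewrite (_ : [set c | _]%SET = finset.set0) ?cards0 ?muln0 //.
apply/setP => c; rewrite !inE; apply/negbTE.
set k := (n - m.+1)%N.
have mn := ltn_ord m.
pose g := ('X - b%:P) ^+ k.+1 * 'X^k.
have Lg : L g != 0 by apply: shift_coef_witness.
have mg : g \is monic by rewrite rpredM ?monicXn // monic_exp ?monicXsubC.
have sg : size g = (k.*2).+2.
  rewrite size_mulXn ?monic_neq0 ?monic_exp ?monicXsubC // size_exp_XsubC.
  by rewrite -addnn !addnS.
(* The degree [2k + 1] of [g] is at most [n] exactly when [n <= m.*2.+1]. A smaller degree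
   contradicts the vanishing of [L] on all [low_poly v]; in degree [n], [g] is itself a
   [monic_poly_of], on which [L] takes the same value as at [c]. *)
have : (size g <= n.+1)%N by rewrite sg /k; lia.
rewrite leq_eqVlt ltnS => /predU1P[sgn|sgn]; last first.
  by have := L0 [ffun i : 'I_n => g`_(n - i.+1)]; rewrite low_polyK // Lg.
have := Lg; rewrite -(monic_polyK mg sgn) !monic_polyE /L !shift_coefD -/L.
set v := [ffun i : 'I_n => _].
by rewrite (eqP (negbFE (L0 c))) (eqP (negbFE (L0 v))).
Qed.

Definition qprod S c : R := \prod_(i in S) chi (c i).

Lemma norm_prod_qchar_le1 (P : pred 'I_n) (f : 'I_n -> F) :
  `|\prod_(i | P i) chi (f i)| <= 1.
Proof.
by rewrite normr_prod; apply: prodr_ile1 => i _; rewrite normr_ge0 qchar_le1.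
Qed.

(* Only the top coordinate [c m] is averaged: the coordinates of index below [m]
   of both [c] and its translate do not depend on it. *)
Lemma correlation_bound S b m : b != 0 -> m \in S ->
    (forall i, i \in S -> (i <= m)%N) -> (n <= m.*2.+1)%N ->
  q * `|\sum_c qprod S c * qprod S (translate b c)| <= 2%:R * q ^+ n.
Proof.
move=> b0 mS Sm nm.
pose L c := shift_coef b (n - m.+1) (monic_poly_of c).
pose G c := (\prod_(i in S | i != m) chi (c i))
            * \prod_(i in S | i != m) chi (translate b c i).
have LE c : translate b c m = c m + L c.
  by rewrite /L /shift_coef coef_monic_poly ffunE; ring.
have G1 c : `|G c| <= 1.
  by rewrite normrM mulr_ile1 ?normr_ge0 // norm_prod_qchar_le1.
have E c t : qprod S (c + unit_dir m t) * qprod S (translate b (c + unit_dir m t))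
    = G c * (chi (c m + t) * chi (c m + t + L c)).
  have e1 : \prod_(i in S | i != m) chi ((c + unit_dir m t) i)
      = \prod_(i in S | i != m) chi (c i).
    by apply: eq_bigr => i /andP[_ /negbTE im]; rewrite !ffunE im addr0.
  have e2 : \prod_(i in S | i != m) chi (translate b (c + unit_dir m t) i)
      = \prod_(i in S | i != m) chi (translate b c i).
    apply: eq_bigr => i /andP[iS /negbTE im].
    by rewrite translate_unit_dir ?Sm // [unit_dir m t i]ffunE im addr0.
  have e3 : unit_dir m t m = t by rewrite ffunE eqxx.
  rewrite /qprod (bigD1 m) //= e1 [X in _ * X](bigD1 m) //= e2.
  rewrite translate_unit_dir // LE e3 [(c + _) m]ffunE e3 /G addrAC; ring.
have inner c : `|\sum_t chi (c m + t) * chi (c m + t + L c)|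
    <= 1 + q * (L c == 0)%:R.
  rewrite (reindex_inj (addrI (- c m))) /=.
  under eq_bigr do rewrite addrA subrr add0r.
  have [->|L0] := eqVneq (L c) 0; last first.
    by rewrite mulr0 addr0; apply: qchar_pair_sum_le1.
  rewrite mulr1 (le_trans (ler_norm_sum _ _ _)) // ler_wpDl //.
  rewrite -[q]sumr_const; apply: ler_sum => t _.
  by rewrite normrM mulr_ile1 ?normr_ge0 ?qchar_le1.
(* Adding [unit_dir m t] permutes the tuples, so [q] copies of the sum become a double sum over [c]
   and [t], and [G c] does not depend on [t]. *)
have -> : q * `|\sum_c qprod S c * qprod S (translate b c)|
    = `|\sum_c G c * \sum_t chi (c m + t) * chi (c m + t + L c)|.
  rewrite -[q]ger0_norm ?ler0n // -normrM -[q]sumr_const mulr_suml.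
  congr `|_|; transitivity (\sum_(t : F) \sum_(c : {ffun 'I_n -> F})
      qprod S (c + unit_dir m t) * qprod S (translate b (c + unit_dir m t))).
    by apply: eq_bigr => t _; rewrite mul1r (reindex_inj (addIr (unit_dir m t))).
  rewrite exchange_big; apply: eq_bigr => c _ /=.
  by rewrite mulr_sumr; apply: eq_bigr => t _; rewrite E.
apply: (le_trans (ler_norm_sum _ _ _)).
apply: (@le_trans _ _ (\sum_c (1 + q * (L c == 0)%:R))).
  apply: ler_sum => c _; rewrite normrM; apply: le_trans (inner c).
  by rewrite ler_piMl.
(* The ones contribute [q ^+ n], and the zeros of [L], weighted by [q], at most [q ^+ n] again. *)
rewrite big_split /= sumr_const card_ffun card_ord natrX -mulr_sumr.
rewrite [leRHS]mulr_natl mulr2n lerD2l -natr_sum -natrM -natrX ler_nat.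
have := card_shift_coef_eq0 b0 nm; congr (_ * _ <= _)%N.
rewrite -sum1_card big_mkcond; apply: eq_bigr => c _.
by rewrite inE; case: eqP.
Qed.

Definition irr_sum S : R := \sum_(c in irr_set F n) qprod S c.

Lemma irr_set_translate b c : (translate b c \in irr_set F n) = (c \in irr_set F n).
Proof. by apply/irr_setP/irr_setP => /irreducible_translate. Qed.

(** [Y c] sums the character product over all translates of [c], so [q * irr_sum S] is the sum of
    [Y] over irreducibles. By Cauchy-Schwarz its square is at most [q ^+ n] times the sum of
    [Y c ^+ 2] over all tuples, and that sum is [q] times the sum of the correlations [E d]. *)
Lemma irr_sum_sqr_le S m : m \in S ->
    (forall i, i \in S -> (i <= m)%N) -> (n <= m.*2.+1)%N ->
  q * irr_sum S ^+ 2 <= 3%:R * (q ^+ n) ^+ 2.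
Proof.
move=> mS Sm nm.
have q0 : 0 < q by rewrite ltr0n (ltn_trans _ (finNzRing_gt1 F)).
pose Y c := \sum_b qprod S (translate b c).
have TY : q * irr_sum S = \sum_(c in irr_set F n) Y c.
  rewrite exchange_big -[q]sumr_const mulr_suml; apply: eq_bigr => b _.
  rewrite mul1r /irr_sum (reindex_inj (can_inj (translateK b))) /=.
  by apply: eq_bigl => c; rewrite irr_set_translate.
pose E d := \sum_c qprod S c * qprod S (translate d c).
have YE : \sum_c Y c ^+ 2 = q * \sum_d E d.
  transitivity (\sum_(b : F) \sum_d E d); last first.
    by rewrite sumr_const mulr_natl.
  transitivity (\sum_b \sum_d \sum_c qprod S (translate b c) * qprod S (translate d c)).
    under [RHS]eq_bigr do rewrite exchange_big.
    rewrite [RHS]exchange_big; apply: eq_bigr => c _ /=.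
    rewrite expr2 mulr_suml; apply: eq_bigr => b _.
    by rewrite mulr_sumr.
  apply: eq_bigr => b _; rewrite (reindex_inj (addrI b)) /=.
  apply: eq_bigr => d _; rewrite /E [RHS](reindex_inj (can_inj (translateK b))) /=.
  by apply: eq_bigr => c _; rewrite translateD.
(* The term [d = 0] is bounded trivially by [q ^+ n]; the others, at most [q] in number, satisfy
   [q * |E d| <= 2 * q ^+ n]. *)
have SE : \sum_d E d <= 3%:R * q ^+ n.
  rewrite (bigD1 0) //= (_ : 3%:R = 1 + 2%:R) // mulrDl mul1r lerD //.
    apply: (@le_trans _ _ (\sum_(c : {ffun 'I_n -> F}) 1)).
      apply: ler_sum => c _; rewrite (le_trans (ler_norm _)) // normrM.
      by rewrite mulr_ile1 ?normr_ge0 // norm_prod_qchar_le1.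
    by rewrite sumr_const card_ffun card_ord natrX.
  rewrite -(ler_pM2l q0) (le_trans (ler_norm _)) // normrM (ger0_norm (ltW q0)).
  apply: (@le_trans _ _ (\sum_(d : F | d != 0) q * `|E d|)).
    by rewrite -mulr_sumr ler_pM2l // ler_norm_sum.
  apply: (@le_trans _ _ (\sum_(d : F | d != 0) 2%:R * q ^+ n)).
    by apply: ler_sum => d d0; apply: correlation_bound mS Sm nm.
  rewrite sumr_const -[leLHS]mulr_natl ler_wpM2r ?mulr_ge0 ?exprn_ge0 ?ler0n //.
  by rewrite ler_nat max_card.
rewrite -(ler_pM2l q0) mulrA -expr2 -exprMn TY.
apply: (le_trans (sqr_sum_le _ _)).
have Y2 : \sum_(c in irr_set F n) Y c ^+ 2 <= \sum_c Y c ^+ 2.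
  rewrite [leRHS](bigID [in irr_set F n]) /= lerDl.
  by apply: sumr_ge0 => c _; apply: sqr_ge0.
apply: (@le_trans _ _ (q ^+ n * (q * (3%:R * q ^+ n)))); last first.
  by rewrite le_eqVlt; apply/orP; left; apply/eqP; ring.
apply: ler_pM => //.
- by apply: sumr_ge0 => c _; apply: sqr_ge0.
- rewrite -natrX ler_nat (leq_trans (max_card _)) //.
  by rewrite card_ffun card_ord.
- by rewrite (le_trans Y2) // YE ler_pM2l.
Qed.

End CharacterSums.

(** * Reversal *)

Section ReversedPolynomial.
Variable F : fieldType.
Implicit Types (p r : {poly F}) (d e n : nat).

(** Reversal is relative to a prescribed [n] rather than to the degree of [p]; this makes it linear,
    and multiplicative in the sense of [rev_polyM]. *)
Definition rev_poly n p : {poly F} := \poly_(j < n.+1) p`_(n - j).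

Lemma coef_rev_poly n p j : (j <= n)%N -> (rev_poly n p)`_j = p`_(n - j).
Proof. by move=> jn; rewrite coef_poly ltnS jn. Qed.

Lemma rev_polyZ n (a : F) p : rev_poly n (a *: p) = a *: rev_poly n p.
Proof.
by apply/polyP => j; rewrite coefZ !coef_poly; case: ifP; rewrite ?mulr0 ?coefZ.
Qed.

Lemma rev_poly_sum n (I : finType) (f : I -> {poly F}) :
  rev_poly n (\sum_i f i) = \sum_i rev_poly n (f i).
Proof.
apply/polyP => j; rewrite coef_sum coef_poly; case: ifP => jn; last first.
  by rewrite big1 // => i _; rewrite coef_poly jn.
by rewrite coef_sum; apply: eq_bigr => i _; rewrite coef_poly jn.
Qed.

Lemma rev_polyXn n i : (i <= n)%N -> rev_poly n 'X^i = 'X^(n - i).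
Proof.
move=> le_in; apply/polyP => j; rewrite coef_poly !coefXn.
case: ifP => jn; last by rewrite (_ : (j == _) = false) //; apply/eqP; lia.
by congr (nat_of_bool _)%:R; apply/eqP/eqP; lia.
Qed.

Lemma rev_polyK n p : (size p <= n.+1)%N -> rev_poly n (rev_poly n p) = p.
Proof.
move=> sp; apply/polyP => j; rewrite coef_poly; case: ifP => jn.
  by rewrite coef_rev_poly ?leq_subr // subKn.
by rewrite nth_default // (leq_trans sp) // leqNgt jn.
Qed.

Lemma poly_sum_coef n p : (size p <= n)%N -> \sum_(i < n) p`_i *: 'X^i = p.
Proof.
move=> sp; rewrite -poly_def; apply/polyP => j; rewrite coef_poly.
by case: ltnP => // nj; rewrite nth_default // (leq_trans sp).
Qed.

Lemma rev_polyE n p : (size p <= n.+1)%N ->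
  rev_poly n p = \sum_(i < n.+1) p`_i *: 'X^(n - i).
Proof.
move=> sp; rewrite -{1}(poly_sum_coef sp) rev_poly_sum.
by apply: eq_bigr => i _; rewrite rev_polyZ rev_polyXn // -ltnS.
Qed.

Lemma rev_polyM d e p r : (size p <= d.+1)%N -> (size r <= e.+1)%N ->
  rev_poly (d + e) (p * r) = rev_poly d p * rev_poly e r.
Proof.
move=> sp sr; rewrite (rev_polyE sp) (rev_polyE sr) big_distrlr /=.
rewrite -{1}(poly_sum_coef sp) -{1}(poly_sum_coef sr) big_distrlr /=.
rewrite rev_poly_sum; apply: eq_bigr => i _; rewrite rev_poly_sum.
apply: eq_bigr => j _; have := ltn_ord i; have := ltn_ord j => lj li.
rewrite -scalerAl -scalerAr scalerA -exprD rev_polyZ rev_polyXn; last by lia.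
rewrite -[in RHS]scalerAl -[in RHS]scalerAr scalerA -exprD.
by congr (_ *: 'X^_); lia.
Qed.

Lemma size_rev_poly n p : p`_0 != 0 -> size (rev_poly n p) = n.+1.
Proof. by move=> p0; rewrite size_poly_eq // subnn. Qed.

(** A factorization of the reversal reverses to one of [p]. Sizes survive because the constant
    coefficient of the reversal is the leading coefficient of [p], so a factor [r] has nonzero
    constant coefficient too. *)
Lemma irreducible_rev_poly n p : size p = n.+1 -> p`_0 != 0 ->
  irreducible_poly p -> irreducible_poly (rev_poly n p).
Proof.
move=> sp p0 [sp1 irr]; have srp := size_rev_poly n p0.
split=> [|r sr1 /dvdpP[s e]]; first by rewrite srp -sp.
have sr0 : s * r != 0 by rewrite -e -size_poly_gt0 srp.
have [s0 r0] : s != 0 /\ r != 0 by apply/norP; rewrite -mulf_eq0.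
have [a sa] : exists a, size s = a.+1.
  by exists (size s).-1; rewrite prednK // size_poly_gt0.
have [b sb] : exists b, size r = b.+1.
  by exists (size r).-1; rewrite prednK // size_poly_gt0.
have en : n = (a + b)%N.
  by apply: succn_inj; rewrite -srp e size_mul // sa sb addnS.
have : (s * r)`_0 != 0.
  rewrite -e coef_rev_poly // subn0 -[n]/(n.+1.-1) -sp -lead_coefE.
  by rewrite lead_coef_eq0 -size_poly_gt0 sp.
rewrite -horner_coef0 hornerM mulf_eq0 => /norP[_]; rewrite horner_coef0 => r00.
have ep : p = rev_poly a s * rev_poly b r.
  by rewrite -rev_polyM ?sa ?sb // -en -e rev_polyK // sp.
have /eqp_size : rev_poly b r %= p.
  by apply: irr; rewrite ?ep ?dvdp_mull // size_rev_poly // -sb.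
rewrite size_rev_poly // sp => -[bn].
by rewrite -dvdp_size_eqp e ?dvdp_mull // -e srp sb bn.
Qed.

End ReversedPolynomial.

Section Reversal.
Variables (F : fieldType) (n : nat).
Implicit Types (c : {ffun 'I_n -> F}).

Definition reverse c : {ffun 'I_n -> F} :=
  [ffun i : 'I_n =>
    (((monic_poly_of c)`_0)^-1 *: rev_poly n (monic_poly_of c))`_(n - i.+1)].

Lemma monic_reverse c : (monic_poly_of c)`_0 != 0 ->
  monic_poly_of (reverse c) =
    ((monic_poly_of c)`_0)^-1 *: rev_poly n (monic_poly_of c).
Proof.
move=> c0; have sr := size_rev_poly n c0; apply: monic_polyK.
  by rewrite monicE lead_coefZ lead_coefE sr coef_rev_poly // subnn mulVf.
by rewrite size_scale ?invr_eq0.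
Qed.

Lemma reverseK c : (monic_poly_of c)`_0 != 0 -> reverse (reverse c) = c.
Proof.
move=> c0; apply: monic_poly_inj.
have sc := size_monic_poly c.
have r0 : (monic_poly_of (reverse c))`_0 = ((monic_poly_of c)`_0)^-1.
  rewrite monic_reverse // coefZ coef_rev_poly // subn0.
  by have := monic_polyP c; rewrite monicE lead_coefE sc => /eqP ->; rewrite mulr1.
rewrite monic_reverse r0 ?invr_eq0 // monic_reverse // rev_polyZ.
by rewrite rev_polyK ?sc // scalerA invrK mulfV // scale1r.
Qed.

Lemma irreducible_reverse c : (monic_poly_of c)`_0 != 0 ->
  irreducible_poly (monic_poly_of c) -> irreducible_poly (monic_poly_of (reverse c)).
Proof.
move=> c0 irr; rewrite monic_reverse //.
have c0' : ((monic_poly_of c)`_0)^-1 != 0 by rewrite invr_eq0.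
have [sp ip] := irreducible_rev_poly (size_monic_poly c) c0 irr.
split=> [|r sr]; first by rewrite size_scale.
by rewrite dvdpZr // => /(ip _ sr)/eqp_trans; apply; rewrite eqp_sym eqp_scale.
Qed.

(** Otherwise ['X] would be a divisor, hence an associate, of a polynomial of degree above 1. *)
Lemma irreducible_coef0_neq0 c : (1 < n)%N ->
  irreducible_poly (monic_poly_of c) -> (monic_poly_of c)`_0 != 0.
Proof.
move=> n1 [_ irr]; apply/negP => /eqP c0.
have /irr : 'X - 0%:P %| monic_poly_of c by rewrite dvdp_XsubCl /root horner_coef0 c0.
rewrite size_XsubC => /(_ isT)/eqp_size; rewrite size_XsubC size_monic_poly.
by move: n1; case: (n) => [|[]].
Qed.

End Reversal.

(** * Bounds for all nonempty index sets, by reversal *)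

Section NontrivialCharacterSums.
Variables (R : realFieldType) (F : finFieldType) (n : nat).
Hypothesis F2 : 2%:R != 0 :> F.
Implicit Types (c : {ffun 'I_n -> F}) (S : {set 'I_n}).

Lemma flip_ord_subproof (i : 'I_n) : (n - i.+2 < n)%N.
Proof. by have := ltn_ord i; lia. Qed.

(* Reversal exchanges the coefficients of x^(i+1) and x^(n-i-1), the latter being
   [c i]. *)
Definition flip_ord (i : 'I_n) : 'I_n := Ordinal (flip_ord_subproof i).

(** Each reversed coefficient is [c (flip_ord i)] divided by [c z], and inversion does not affect
    the character. The factor [c z] thus appears [#|S|] times, and only the parity of this number
    matters. *)
Lemma qprod_reverse S (z : 'I_n) c : z.+1 = n -> c z != 0 ->
    (forall i, i \in S -> i.+1 < n)%N ->
  qprod R S (reverse c) =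
    qprod R ((if odd #|S| then [set z]%SET else finset.set0) :|: flip_ord @: S)%SET c.
Proof.
move=> zn cz0 Sn.
have c0 : (monic_poly_of c)`_0 = c z.
  by rewrite -coef_monic_poly zn subnn.
have rE i : i \in S -> reverse c i = (c z)^-1 * c (flip_ord i).
  move=> iS; rewrite ffunE coefZ c0 coef_rev_poly ?leq_subr //.
  rewrite -(coef_monic_poly c (flip_ord i)).
  by congr (_ * nth _ _ _) => /=; have := Sn i iS; lia.
(* Injectivity holds only away from the last index, where the truncated subtraction returns 0. *)
have inj : {in S &, injective flip_ord}.
  move=> i j iS jS /(congr1 val) /=; have := Sn i iS; have := Sn j jS => lj li e.
  by apply: val_inj => /=; lia.
have zS : z \notin (flip_ord @: S)%SET.
  apply/negP => /imsetP[i iS /(congr1 val) /=]; have := Sn i iS; lia.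
rewrite /qprod.
have -> : \prod_(i in S) qchar R (reverse c i) =
    qchar R (c z) ^+ #|S| * \prod_(i in (flip_ord @: S)%SET) qchar R (c i).
  rewrite big_imset //= -prodr_const -big_split; apply: eq_bigr => i iS.
  by rewrite rE //= qcharM // qcharV.
have oS : qchar R (c z) ^+ #|S| = if odd #|S| then qchar R (c z) else 1.
  have e2 : qchar R (c z) ^+ #|S|./2.*2 = 1.
    by rewrite -mul2n exprM expr2 qcharMM // expr1n.
  rewrite -{1}(odd_double_half #|S|) exprD e2 mulr1.
  by case: odd; rewrite ?expr1 ?expr0.
rewrite oS; case: odd; last by rewrite finset.set0U mul1r.
by rewrite big_setU1.
Qed.

Lemma irr_sum_reverse S (z : 'I_n) : z.+1 = n -> (1 < n)%N ->
    (forall i, i \in S -> i.+1 < n)%N ->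
  irr_sum R F S = irr_sum R F
    ((if odd #|S| then [set z]%SET else finset.set0) :|: flip_ord @: S)%SET.
Proof.
move=> zn n1 Sn; rewrite /irr_sum.
have c0 c : c \in irr_set F n -> (monic_poly_of c)`_0 != 0.
  by move/irr_setP/(irreducible_coef0_neq0 n1).
have rI c : c \in irr_set F n -> reverse c \in irr_set F n.
  by move=> cI; apply/irr_setP/irreducible_reverse/irr_setP => //; apply: c0.
rewrite (reindex_onto (@reverse F n) (@reverse F n)) /=; last first.
  by move=> c /c0/reverseK.
apply: eq_big => [c|c].
  apply/andP/idP => [[cI /eqP <-]|cI]; first exact: rI.
  by rewrite rI // reverseK ?c0.
case/andP=> cI /eqP e; apply: qprod_reverse => //.
have : (monic_poly_of c)`_0 != 0 by apply: c0; rewrite -e rI.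
by rewrite -coef_monic_poly zn subnn.
Qed.

Lemma irr_sum_sqr_bound S : S != finset.set0 ->
  #|F|%:R * irr_sum R F S ^+ 2 <= 3%:R * (#|F|%:R ^+ n) ^+ 2.
Proof.
case/set0Pn => i0 i0S.
case: (@arg_maxnP _ i0 [in S] (fun i : 'I_n => i : nat) i0S) => m mS Sm.
have [nm|mn] := leqP n m.*2.+1; first exact: irr_sum_sqr_le mS Sm nm.
have n1 : (1 < n)%N by lia.
have zlt : (n.-1 < n)%N by lia.
pose z := Ordinal zlt.
have zn : z.+1 = n by rewrite /=; lia.
have Sn i : i \in S -> (i.+1 < n)%N by move/Sm => /=; lia.
rewrite (irr_sum_reverse zn n1 Sn); case: ifPn => oS.
  (* For odd [#|S|] the new set contains the last index [z], which serves as its maximum. *)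
  apply: (@irr_sum_sqr_le _ _ _ F2 _ z) => [|i _|/=].
  - by rewrite !inE eqxx.
  - by rewrite /=; have := ltn_ord i; lia.
  - by lia.
rewrite finset.set0U.
case: (@arg_minnP _ i0 [in S] (fun i : 'I_n => i : nat) i0S) => l lS Sl.
(* For even [#|S|] the new maximum is the flip of the least index [l], and [n <= (flip_ord l).*2.+1]
   requires [2l + 3 <= n]. This follows from [m.*2.+1 < n] because [l < m], the set having more than
   one element. *)
have lm : (l < m)%N.
  rewrite ltn_neqAle Sl // andbT; apply: contra oS => /eqP lm.
  suff -> : S = [set m]%SET by rewrite cards1.
  apply/setP => i; rewrite inE; apply/idP/eqP => [iS|->] //; apply: val_inj.
  by have /= := Sm i iS; have := Sl i iS; lia.
apply: (@irr_sum_sqr_le _ _ _ F2 _ (flip_ord l)) => [|i|/=].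
- exact: imset_f.
- by case/imsetP => j jS -> /=; have := Sl j jS; lia.
- by lia.
Qed.

End NontrivialCharacterSums.

(** * Irreducible polynomials with square coefficients *)

Section SquareCoefficients.
Variables (R : rcfType) (F : finFieldType) (n : nat).
Hypothesis n_gt0 : (0 < n)%N.
Local Notation q := (#|F|%:R : R).
Local Notation y := ((Num.sqrt q)^-1).
Local Notation N := (#|irr_set F n|%:R : R).

Definition irr_square_set : {set {ffun 'I_n -> F}} :=
  [set c in irr_set F n | [forall i, c i \in squares F]]%SET.
Local Notation M := (#|irr_square_set|%:R : R).

Lemma card_gt0R : 0 < q.
Proof. by rewrite ltr0n (ltn_trans _ (finNzRing_gt1 F)). Qed.

Lemma card_coord_eq0 (i : 'I_n) :
  (#|F| * #|[set c : {ffun 'I_n -> F} | c i == 0%R]%SET| = #|F| ^ n)%N.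
Proof.
rewrite -sum1_card -sum_nat_const.
transitivity (\sum_(t : F) \sum_(c : {ffun 'I_n -> F}) ((c i + t)%R == 0%R))%N.
  apply: eq_bigr => t _; rewrite big_mkcond /= (reindex_inj (addIr (unit_dir i t))).
  by apply: eq_bigr => c _; rewrite inE !ffunE eqxx; case: ifP.
rewrite exchange_big /= -[in RHS](card_ord n) -card_ffun -sum1_card.
apply: eq_bigr => c _; rewrite (bigD1 (- c i)) //= subrr eqxx big1 // => t tn.
by apply/eqP; rewrite eqb0 addrC addr_eq0.
Qed.

Lemma inv_card_le : q^-1 <= y.
Proof.
have q1 : 1 <= q by rewrite ler1n (ltn_trans _ (finNzRing_gt1 F)).
have s1 : 1 <= Num.sqrt q by rewrite -[leLHS]sqrtr1 ler_wsqrtr.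
rewrite -[in leLHS](sqr_sqrtr (ltW card_gt0R)) lef_pV2 ?posrE.
- by rewrite expr2 ler_peMr // (le_trans ler01).
- by rewrite exprn_gt0 // (lt_le_trans ltr01).
- by rewrite (lt_le_trans ltr01).
Qed.

Lemma card_irr_set_approx : `|N - q ^+ n / n%:R| <= q ^+ n * q^-1.
Proof.
have [lo hi] := count_irreducible F n_gt0.
have n0 : 0 < n%:R :> R by rewrite ltr0n.
rewrite -(ler_pM2l n0) -[X in X * _ <= _]ger0_norm ?ler0n // -normrM mulrBr.
rewrite [n%:R * (_ / _)]mulrC divfK ?gt_eqF //.
have -> : q ^+ n * q^-1 = q ^+ n.-1.
  by rewrite -{1}(prednK n_gt0) exprSr mulfK ?gt_eqF // card_gt0R.
rewrite distrC ger0_norm; last by rewrite subr_ge0 -natrX -natrM ler_nat.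
by rewrite lerBlDl -!natrX -!natrM -natrD ler_nat.
Qed.

(** The square root of [irr_sum_sqr_bound], with the square root of 3 rounded up to 2. *)
Lemma irr_sum_le (S : {set 'I_n}) : 2%:R != 0 :> F -> S != finset.set0 ->
  `|irr_sum R F S| <= 2%:R * q ^+ n * y.
Proof.
move=> F2 S0; have q0 := card_gt0R.
have y0 : 0 < y by rewrite invr_gt0 sqrtr_gt0.
have r0 : 0 <= 2%:R * q ^+ n * y.
  by rewrite mulr_ge0 ?mulr_ge0 ?exprn_ge0 ?ler0n ?ltW.
rewrite -(@ler_pXn2r _ 2%N) ?nnegrE ?normr_ge0 // real_normK ?num_real //.
rewrite -(ler_pM2l q0).
apply: (le_trans (irr_sum_sqr_bound R F2 S0)).
have -> : q * (2%:R * q ^+ n * y) ^+ 2 = 4%:R * (q ^+ n) ^+ 2.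
  have qy : q * y ^+ 2 = 1 by rewrite exprVn sqr_sqrtr ?ltW // mulfV // gt_eqF.
  by rewrite exprMn mulrCA qy; ring.
by rewrite ler_wpM2r ?sqr_ge0 // ler_nat.
Qed.

Lemma character_expansion :
  \sum_(c in irr_set F n) \prod_i (1 + qchar R (c i)) =
  \sum_(S : {set 'I_n}) irr_sum R F S.
Proof.
rewrite exchange_big; apply: eq_bigr => c _ /=.
rewrite (eq_bigr (fun i => qchar R (c i) + 1)); last by move=> i _; rewrite addrC.
rewrite bigA_distr; apply: eq_bigr => S _.
by rewrite /qprod [RHS]big_mkcond.
Qed.

Lemma square_weight_dist (x : F) : x != 0 ->
  2%:R * (x \in squares F)%:R = 1 + qchar R x.
Proof.
by move=> /negbTE x0; rewrite /qchar x0; case: ifP => _; rewrite ?mulr1 ?mulr0 ?subrr.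
Qed.

Lemma prod_le_exp2 (f : 'I_n -> R) : (forall i, 0 <= f i <= 2%:R) ->
  0 <= \prod_i f i <= 2%:R ^+ n.
Proof.
move=> f2; rewrite prodr_ge0 /= => [|i _]; last by case/andP: (f2 i).
rewrite -[n in leRHS]card_ord -prodr_const.
by apply: ler_prod => i _; apply: f2.
Qed.

(** The two weights agree unless some coefficient vanishes. Then both lie between 0 and [2 ^+ n],
    and each of the [n] coordinates vanishes on a proportion [q^-1] of the tuples. *)
Lemma square_weights_approx :
  `|\sum_(c in irr_set F n) \prod_i (2%:R * (c i \in squares F)%:R)
    - \sum_(c in irr_set F n) \prod_i (1 + qchar R (c i))|
  <= 2%:R ^+ n * n%:R * (q ^+ n * q^-1).
Proof.
rewrite -sumrB; apply: (le_trans (ler_norm_sum _ _ _)).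
apply: (@le_trans _ _ (\sum_(c : {ffun 'I_n -> F}) \sum_i 2%:R ^+ n * (c i == 0)%:R)).
  rewrite [leRHS](bigID [in irr_set F n]) /= ler_wpDr //.
    by do 2?[apply: sumr_ge0 => ? _]; rewrite mulr_ge0 ?exprn_ge0 ?ler0n.
  apply: ler_sum => c _.
  have [/existsP[i /eqP ci]|/existsPn c0] := boolP [exists i, c i == 0].
    apply: (@le_trans _ _ (2%:R ^+ n)); last first.
      rewrite (bigD1 i) //= ci eqxx mulr1 ler_wpDr //.
      by apply: sumr_ge0 => ? _; rewrite mulr_ge0 ?exprn_ge0 ?ler0n.
    have /andP[a0 a2] : 0 <= \prod_i (2%:R * (c i \in squares F)%:R : R) <= 2%:R ^+ n.
      by apply: prod_le_exp2 => j; case: (_ \in _); rewrite ?mulr0 ?mulr1 ?lexx ?ler0n.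
    have /andP[b0 b2] : 0 <= \prod_i (1 + qchar R (c i)) <= 2%:R ^+ n.
      apply: prod_le_exp2 => j; have := qchar_le1 R (c j).
      by rewrite ler_norml => /andP[? ?]; apply/andP; split; lra.
    by rewrite ler_norml; apply/andP; split; lra.
  rewrite (eq_bigr (fun i => 1 + qchar R (c i))) => [|i _]; last first.
    exact: square_weight_dist.
  by rewrite subrr normr0 sumr_ge0 // => i _; rewrite mulr_ge0 ?exprn_ge0 ?ler0n.
rewrite exchange_big /= -mulrA -[in leRHS]mulrCA.
rewrite (eq_bigr (fun=> 2%:R ^+ n * (q ^+ n * q^-1))) => [|i _].
  by rewrite sumr_const card_ord [leRHS]mulr_natl.
rewrite -mulr_sumr -natr_sum; congr (_ * _).
have -> : (\sum_(c : {ffun 'I_n -> F}) (c i == 0%R) =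
    #|[set c : {ffun 'I_n -> F} | c i == 0%R]%SET|)%N.
  by rewrite -sum1_card [RHS]big_mkcond; apply: eq_bigr => c _; rewrite inE; case: eqP.
by rewrite -natrX -(card_coord_eq0 i) natrM mulrAC mulfV ?mul1r // gt_eqF // card_gt0R.
Qed.

(** In the constant, [2 ^+ n * n] comes from vanishing coefficients, [2 ^+ n * 2] from the
    nontrivial character sums, one unit from counting irreducibles, and one from replacing [q] by
    [q + 1], twice the number of squares. *)
Lemma irr_square_odd : 2%:R != 0 :> F ->
  `|M / #|squares F|%:R ^+ n - n%:R^-1|
    <= (2%:R ^+ n * (n%:R + 2%:R) + 2%:R) * y.
Proof.
move=> F2; have q0 := card_gt0R; have yle := inv_card_le.
have y0 : 0 < y by rewrite invr_gt0 sqrtr_gt0.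
have qn0 : 0 < q ^+ n by rewrite exprn_gt0.
have p0 : 0 < 2%:R ^+ n :> R by rewrite exprn_gt0 ?ltr0n.
have n1 : 1 <= n%:R :> R by rewrite ler1n.
have weights : 2%:R ^+ n * M =
    \sum_(c in irr_set F n) \prod_i (2%:R * (c i \in squares F)%:R).
  rewrite mulr_natr -sumr_const big_mkcond [RHS]big_mkcond /=.
  apply: eq_bigr => c _; rewrite inE; case: (c \in irr_set F n) => //=.
  case: forallP => [cS|/forallP]; last first.
    rewrite negb_forall => /existsP[i /negbTE ci].
    by rewrite (bigD1 i) //= ci mulr0 mul0r.
  rewrite (eq_bigr (fun=> 2%:R)) ?prodr_const ?card_ord // => i _.
  by rewrite cS mulr1.
have sums : `|\sum_(c in irr_set F n) \prod_i (1 + qchar R (c i)) - N|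
    <= 2%:R ^+ n * (2%:R * q ^+ n * y).
  rewrite character_expansion (bigD1 finset.set0) //=.
  have -> : irr_sum R F (finset.set0 : {set 'I_n}) = N.
    rewrite /irr_sum -sumr_const; apply: eq_bigr => c _.
    by rewrite /qprod finset.big_set0.
  rewrite addrAC subrr add0r (le_trans (ler_norm_sum _ _ _)) //.
  apply: (@le_trans _ _ (\sum_(S : {set 'I_n}) 2%:R * q ^+ n * y)); last first.
    have cS : #|{: {set 'I_n}}| = (2 ^ n)%N.
      by rewrite -cardsT -powersetT card_powerset cardsT card_ord.
    by rewrite sumr_const cS -[leLHS]mulr_natl natrX.
  rewrite [leRHS](bigD1 finset.set0) //= ler_wpDl //.
  by apply: ler_sum => S S0; apply: irr_sum_le.
have appr := card_irr_set_approx; have wts := square_weights_approx.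
have s2 : 2%:R * #|squares F|%:R = q + 1.
  by rewrite -natrM mul2n card_squares_odd // -natr1.
have main : `|2%:R ^+ n * M - q ^+ n / n%:R|
    <= (2%:R ^+ n * (n%:R + 2%:R) + 1) * (q ^+ n * y).
  rewrite -weights in wts.
  have h : q ^+ n * q^-1 <= q ^+ n * y by rewrite ler_pM2l.
  have h2 : 2%:R ^+ n * n%:R * (q ^+ n * q^-1) <= 2%:R ^+ n * n%:R * (q ^+ n * y).
    by rewrite ler_pM2l ?mulr_gt0 // (lt_le_trans ltr01).
  move: wts sums appr; rewrite !ler_norml => /andP[? ?] /andP[? ?] /andP[? ?].
  by apply/andP; split; lra.
set x := q / (q + 1).
have x01 : 0 <= x <= 1.
  by rewrite divr_ge0 ?addr_ge0 ?ler0n //= ler_pdivrMr ?ltr_wpDl ?ler0n // mul1r lerDl.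
(* Bernoulli's inequality; its factor [n] will cancel against the main term [1 / n]. *)
have xn k : 1 - x ^+ k <= k%:R * (1 - x).
  elim: k => [|k IH]; first by rewrite subrr mul0r.
  have /andP[x0 x1] := x01.
  have xk1 : x ^+ k <= 1 by rewrite exprn_ile1.
  have h : x ^+ k * (1 - x) <= 1 - x by rewrite ler_piMl // subr_ge0.
  by rewrite exprSr -natr1; lra.
have Z0 : 0 < q + 1 by rewrite ltr_wpDl ?ler0n.
have Zn0 : 0 < (q + 1) ^+ n by rewrite exprn_gt0.
have xle : 1 - x <= y.
  apply: le_trans yle; rewrite /x -{1}(@divff _ (q + 1)) ?gt_eqF // -mulrBl.
  by rewrite addrAC subrr add0r mul1r lef_pV2 ?posrE // lerDl.
have s0 : (#|squares F|%:R : R) != 0.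
  by apply/eqP => s0; move: s2 Z0; rewrite s0 mulr0 => <-; rewrite ltxx.
have -> : M / #|squares F|%:R ^+ n - n%:R^-1
    = (2%:R ^+ n * M - q ^+ n / n%:R) / (q + 1) ^+ n - (1 - x ^+ n) / n%:R.
  have eM : M / #|squares F|%:R ^+ n = 2%:R ^+ n * M / (q + 1) ^+ n.
    by rewrite -s2 exprMn; field; rewrite !expf_neq0 //= pnatr_eq0.
  have ex : x ^+ n = q ^+ n / (q + 1) ^+ n by rewrite expr_div_n.
  by rewrite eM ex; field; rewrite (gt_eqF Zn0) pnatr_eq0 -lt0n n_gt0.
apply: (le_trans (ler_normB _ _)).
have -> : (2%:R ^+ n * (n%:R + 2%:R) + 2%:R) * y
  = (2%:R ^+ n * (n%:R + 2%:R) + 1) * y + y by ring.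
have n0 : 0 < n%:R :> R by rewrite ltr0n.
apply: lerD.
  rewrite normrM normfV (gtr0_norm Zn0) ler_pdivrMr //; apply: (le_trans main).
  rewrite -[leRHS]mulrA ler_pM2l; last first.
    by rewrite addr_gt0 // mulr_gt0 // addr_gt0.
  by rewrite [leRHS]mulrC ler_pM2r // lerXn2r ?nnegrE ?ler0n ?lerDl // ltW.
have xn0 : 0 <= 1 - x ^+ n by have /andP[? ?] := x01; rewrite subr_ge0 exprn_ile1.
rewrite ger0_norm ?divr_ge0 ?ler0n // ler_pdivrMr //.
apply: (le_trans (xn n)); rewrite mulrC ler_pM2r //.
Qed.

(** In characteristic 2 squaring is injective, so every element is a square and the plain count of
    irreducibles suffices. *)
Lemma irr_square_even : 2%:R = 0 :> F ->
  `|M / #|squares F|%:R ^+ n - n%:R^-1| <= y.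
Proof.
move=> F2; have q0 := card_gt0R; have yle := inv_card_le.
have sT : squares F = finset.setT.
  apply/eqP; rewrite eqEcard finset.subsetT /= cardsT /squares card_imset // => a b.
  move=> e; apply/eqP; rewrite -subr_eq0 -sqrf_eq0 sqrrB e.
  by rewrite -mulr_natr F2 mulr0 subr0 -mulr2n -mulr_natr F2 mulr0.
have -> : irr_square_set = irr_set F n.
  apply/setP => c; rewrite inE andb_idr // => _.
  by apply/forallP => i; rewrite sT inE.
have qn0 : 0 < q ^+ n by rewrite exprn_gt0.
rewrite sT cardsT; apply: (le_trans _ yle).
rewrite -(ler_pM2l qn0) -{1}[q ^+ n]gtr0_norm // -normrM.
have := card_irr_set_approx; congr (`|_| <= _).
by rewrite mulrBr mulrCA mulfV ?mulr1 // gt_eqF.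
Qed.

End SquareCoefficients.

(** * From counting to probability *)

Lemma probability_irreducible (R : realType) (n : nat) (F : finFieldType)
    (d : measure_display) (T : measurableType d) (P : probability T R)
    (xi : 'I_n -> T -> F) :
    (forall i, discrete_rv (xi i)) -> mutually_independent P xi ->
    (forall i, uniform_on P (squares F) (xi i)) ->
  P [set w | irreducible_poly (monic_poly_of (fun i => xi i w))]
    = (#|irr_square_set F n|%:R / #|squares F|%:R ^+ n)%:E.
Proof.
move=> mxi indep unif.
(* [A c] is the event that the coefficient vector equals [c]. These events are disjoint, and
   independence over the full index set gives their probabilities. *)
pose A (c : {ffun 'I_n -> F}) :=
  \bigcap_(i in [set` (finset.setT : {set 'I_n})]) (xi i @^-1` [set c i]).
have ext w c : A c w <-> c = [ffun i => xi i w].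
  split=> [Acw|-> i _ /=]; last by rewrite ffunE.
  by apply/ffunP => i; rewrite ffunE (Acw i) //= inE.
have mA c : measurable (A c).
  apply: fin_bigcap_measurable => [|i _]; first exact: finite_finset.
  exact: mxi.
have PA c : P (A c) =
    ((#|squares F|%:R ^+ n)^-1 * [forall i, c i \in squares F]%:R)%:E.
  rewrite (indep finset.setT (fun i => [set c i])).
  under eq_bigr do rewrite unif.
  rewrite prodEFin; congr EFin.
  case: forallP => [cS|/forallP].
    rewrite mulr1 (eq_bigr (fun=> (#|squares F|%:R)^-1)) => [|i _]; last by rewrite cS.
    by rewrite prodr_const cardsT card_ord exprVn.
  rewrite negb_forall => /existsP[i /negbTE ci].
  by rewrite (bigD1 i) ?inE //= ci mul0r mulr0.
have -> : [set w | irreducible_poly (monic_poly_of (fun i => xi i w))]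
    = \bigcup_(c in [set` enum (irr_set F n)]) A c.
  have pE w : monic_poly_of [ffun i => xi i w] = monic_poly_of (fun i => xi i w).
    by congr (_ + _); apply: eq_bigr => i _; rewrite ffunE.
  apply/seteqP; split=> w /=.
    move=> irr; exists [ffun i => xi i w]; last exact/ext.
    by rewrite /= mem_enum; apply/irr_setP; rewrite pE.
  by move=> [c] /=; rewrite mem_enum => /irr_setP irr /ext e; rewrite -pE -e.
rewrite measure_fin_bigcup //; last first.
  by move=> c e _ _ [w [/ext -> /ext ->]].
rewrite -fsbig_seq ?enum_uniq // big_enum /=.
rewrite (eq_bigr _ (fun c _ => PA c)) sumEFin; congr EFin.
rewrite -mulr_sumr mulrC; congr (_ * _); rewrite -[RHS]sumr_const.
rewrite [LHS]big_mkcond [RHS]big_mkcond; apply: eq_bigr => c _.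
by rewrite [in RHS]inE; case: (c \in irr_set F n) => //=; case: [forall _, _].
Qed.

Theorem theorem1p1 (R : realType) (n : nat) (n_gt0 : (0 < n)%N) :
  exists C : R,
    forall (F : finFieldType) (d : measure_display) (T : measurableType d)
      (P : probability T R) (xi : 'I_n -> T -> F),
      (forall i, discrete_rv (xi i)) ->
      mutually_independent P xi ->
      (forall i, uniform_on P (squares F) (xi i)) ->
      (`| P [set w | irreducible_poly (monic_poly_of (fun i => xi i w))]
          - (n%:R^-1)%:E |
        <= (C * (#|F|%:R `^ (- 2^-1)))%:E)%E.
Proof.
exists (2%:R ^+ n * (n%:R + 2%:R) + 2%:R) => F d T P xi mxi indep unif.
rewrite (probability_irreducible mxi indep unif) -EFinB abse_EFin lee_fin.
rewrite powRN powR12_sqrt ?ler0n //.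
(* The constant is the one for odd [q]; being at least 1, it also covers characteristic 2. *)
have [F2|F2] := eqVneq (2%:R : F) 0; last exact: irr_square_odd.
apply: (le_trans (irr_square_even R n_gt0 F2)).
by rewrite ler_peMl ?invr_ge0 ?sqrtr_ge0 // ler_wpDl ?ler1n.
Qed.
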